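(* For every sequent $\Gamma\Rightarrow\Delta$: if $\Gamma\models\Delta$ (i.e. $\Gamma\Rightarrow\Delta$ is valid in all $\mathsf{iSL}_\Box$-models), then $\Gamma\Rightarrow\Delta$ is derivable in $\mathsf{G4iSL}'_\Box$.
   Context: Formulas are built from the constant $\bot$, atoms (propositional variables) $p,q,r,\dots$, binary connectives $\wedge,\vee,\to$ and the unary modal operator $\Box$ (there is no $\Diamond$); $\neg\varphi$ abbreviates $\varphi\to\bot$; $\bot$ is not an atom. A sequent is an expression $\Gamma\Rightarrow\Delta$ with $\Gamma,\Delta$ finite multisets of formulas, $\Delta$ containing at most one formula. $\Gamma,\Pi$ denotes multiset union. $\Box\Gamma$ is the multiset $\{\Box\varphi\mid\varphi\in\Gamma\}$ and $\boxdot\Gamma=\Gamma\cup\Box\Gamma$ (multiset union). A formula is boxed if it has the form $\Box\psi$. The calculus $\mathsf{G4iSL}'_\Box$ has the following axioms and rules (''from premises infer conclusion''); it has no cut rule: At: $\Gamma,p\Rightarrow p$ ($p$ an atom). $L\bot$: $\Gamma,\bot\Rightarrow\Delta$. $R\wedge$: from $\Gamma\Rightarrow\varphi$ and $\Gamma\Rightarrow\psi$ infer $\Gamma\Rightarrow\varphi\wedge\psi$. $L\wedge$: from $\Gamma,\varphi,\psi\Rightarrow\Delta$ infer $\Gamma,\varphi\wedge\psi\Rightarrow\Delta$. $R\vee$: from $\Gamma\Rightarrow\varphi_i$ ($i=0$ or $1$) infer $\Gamma\Rightarrow\varphi_0\vee\varphi_1$. $L\vee$: from $\Gamma,\varphi\Rightarrow\Delta$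 and $\Gamma,\psi\Rightarrow\Delta$ infer $\Gamma,\varphi\vee\psi\Rightarrow\Delta$. $R{\to}$: from $\Gamma,\varphi\Rightarrow\psi$ infer $\Gamma\Rightarrow\varphi\to\psi$. $Lp{\to}$: from $\Gamma,p,\varphi\Rightarrow\Delta$ infer $\Gamma,p,p\to\varphi\Rightarrow\Delta$ ($p$ an atom). $L{\wedge}{\to}$: from $\Gamma,\varphi\to(\psi\to\gamma)\Rightarrow\Delta$ infer $\Gamma,\varphi\wedge\psi\to\gamma\Rightarrow\Delta$. $L{\vee}{\to}$: from $\Gamma,\varphi\to\gamma,\psi\to\gamma\Rightarrow\Delta$ infer $\Gamma,\varphi\vee\psi\to\gamma\Rightarrow\Delta$. $L{\to}{\to}'$: from $\Gamma,\psi\to\gamma,\varphi\Rightarrow\psi$ and $\Gamma,\gamma\Rightarrow\Delta$ infer $\Gamma,(\varphi\to\psi)\to\gamma\Rightarrow\Delta$. $\to_{\rm SL}$: from $\Pi,\boxdot\Gamma,\Box\varphi,\Box\varphi\to\psi\Rightarrow\varphi$ and $\Pi,\Box\Gamma,\psi\Rightarrow\Delta$ infer $\Pi,\Box\Gamma,\Box\varphi\to\psi\Rightarrow\Delta$, where $\Pi$ contains no boxed formulas. $\mathcal R^4_{\rm SL}$: from $\Pi,\boxdot\Gamma,\Box\varphi\Rightarrow\varphi$ infer $\Pi,\Box\Gamma\Rightarrow\Box\varphi$, where $\Pi$ contains no boxed formulas. An $\mathsf{iSL}_\Box$-model is a tuple $\mathcal M=(W,\leq,R,V)$ where $W$ is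 a non-empty set, $\leq$ is a partial order on $W$, $R$ is a binary relation on $W$ such that $w\leq v R x$ implies $wRx$, $V:W\times\mathrm{Atoms}\to\{0,1\}$ is such that $w\leq v$ and $V(w,p)=1$ imply $V(v,p)=1$; moreover $R$ is transitive, $R$ is conversely well-founded (there is no infinite path $w_0Rw_1Rw_2R\cdots$), and $wRx$ implies $w\leq x$. Forcing: $\mathcal M,w\Vdash p$ iff $V(w,p)=1$; $\mathcal M,w\Vdash\bot$ never; $\wedge$ and $\vee$ are evaluated pointwise at $w$; $\mathcal M,w\Vdash\varphi\to\psi$ iff for all $v\geq w$, $\mathcal M,v\Vdash\varphi$ implies $\mathcal M,v\Vdash\psi$; $\mathcal M,w\Vdash\Box\varphi$ iff $\mathcal M,x\Vdash\varphi$ for all $x$ with $wRx$. Write $\mathcal M,w\Vdash\Gamma$ if $\mathcal M,w\Vdash\varphi$ for every $\varphi\in\Gamma$. A sequent $\Gamma\Rightarrow\Delta$ is valid in $\mathcal M$ if for all $w\in W$, $\mathcal M,w\Vdash\Gamma$ implies $\mathcal M,w\Vdash\Delta$, where an empty succedent $\Delta$ is read as $\bot$ (i.e. is never forced). $\Gamma\models\Delta$ means that $\Gamma\Rightarrow\Delta$ is valid in every $\mathsf{iSL}_\Box$-model. *)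

(* Defs.v *)
From HB Require Import structures.
From mathcomp Require Import all_boot finmap multiset.

Set Implicit Arguments.
Unset Strict Implicit.
Unset Printing Implicit Defensive.

Local Open Scope mset_scope.

Inductive formula : Type :=
  | Bot
  | Atom of nat
  | And of formula & formula
  | Or of formula & formula
  | Imp of formula & formula
  | Box of formula.

Fixpoint formula_encode (f : formula) : GenTree.tree nat :=
  match f with
  | Bot => GenTree.Node 0 [::]
  | Atom p => GenTree.Leaf p
  | And f g => GenTree.Node 1 [:: formula_encode f; formula_encode g]
  | Or f g => GenTree.Node 2 [:: formula_encode f; formula_encode g]
  | Imp f g => GenTree.Node 3 [:: formula_encode f; formula_encode g]
  | Box f => GenTree.Node 4 [:: formula_encode f]
  end.

Fixpoint formula_decode (t : GenTree.tree nat) : formula :=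
  match t with
  | GenTree.Leaf p => Atom p
  | GenTree.Node 1 [:: t; u] => And (formula_decode t) (formula_decode u)
  | GenTree.Node 2 [:: t; u] => Or (formula_decode t) (formula_decode u)
  | GenTree.Node 3 [:: t; u] => Imp (formula_decode t) (formula_decode u)
  | GenTree.Node 4 [:: t] => Box (formula_decode t)
  | GenTree.Node _ _ => Bot
  end.

Lemma formula_encodeK : cancel formula_encode formula_decode.
Proof. by elim=> //= [f -> g ->|f -> g ->|f -> g ->|f ->]. Qed.

HB.instance Definition _ := Countable.copy formula (can_type formula_encodeK).

Definition boxed (f : formula) : bool := if f is Box _ then true else false.

(* Multiset image: multiplicities add up. *)
Definition box_mset (G : {mset formula}) : {mset formula} :=
  seq_mset [seq Box f | f <- G].

(* Here and below the union of multisets is the additive one, `+`, and not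
   `|`, which takes the maximum of the multiplicities. *)
Definition boxdot (G : {mset formula}) : {mset formula} := G `+` box_mset G.

(* The succedent holds at most one formula; [None] is the empty succedent. *)
Inductive G4iSL_box' : {mset formula} -> option formula -> Prop :=
  | G4_At G p :
      G4iSL_box' (Atom p +` G) (Some (Atom p))
  | G4_LBot G D :
      G4iSL_box' (Bot +` G) D
  | G4_RAnd G f g :
      G4iSL_box' G (Some f) -> G4iSL_box' G (Some g) ->
      G4iSL_box' G (Some (And f g))
  | G4_LAnd G f g D :
      G4iSL_box' (f +` (g +` G)) D ->
      G4iSL_box' (And f g +` G) D
  | G4_ROr0 G f g :
      G4iSL_box' G (Some f) ->
      G4iSL_box' G (Some (Or f g))
  | G4_ROr1 G f g :
      G4iSL_box' G (Some g) ->
      G4iSL_box' G (Some (Or f g))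
  | G4_LOr G f g D :
      G4iSL_box' (f +` G) D -> G4iSL_box' (g +` G) D ->
      G4iSL_box' (Or f g +` G) D
  | G4_RImp G f g :
      G4iSL_box' (f +` G) (Some g) ->
      G4iSL_box' G (Some (Imp f g))
  | G4_LAtomImp G p f D :
      G4iSL_box' (Atom p +` (f +` G)) D ->
      G4iSL_box' (Atom p +` (Imp (Atom p) f +` G)) D
  | G4_LAndImp G f g h D :
      G4iSL_box' (Imp f (Imp g h) +` G) D ->
      G4iSL_box' (Imp (And f g) h +` G) D
  | G4_LOrImp G f g h D :
      G4iSL_box' (Imp f h +` (Imp g h +` G)) D ->
      G4iSL_box' (Imp (Or f g) h +` G) D
  | G4_LImpImp G f g h D :
      G4iSL_box' (Imp g h +` (f +` G)) (Some g) ->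
      G4iSL_box' (h +` G) D ->
      G4iSL_box' (Imp (Imp f g) h +` G) D
  | G4_ImpSL P G f g D :
      (forall h, h \in P -> ~~ boxed h) ->
      G4iSL_box' (Box f +` (Imp (Box f) g +` (P `+` boxdot G))) (Some f) ->
      G4iSL_box' (g +` (P `+` box_mset G)) D ->
      G4iSL_box' (Imp (Box f) g +` (P `+` box_mset G)) D
  | G4_R4SL P G f :
      (forall h, h \in P -> ~~ boxed h) ->
      G4iSL_box' (Box f +` (P `+` boxdot G)) (Some f) ->
      G4iSL_box' (P `+` box_mset G) (Some (Box f)).

Record iSL_box_model : Type := ISLBoxModel {
  world : Type;
  world_inhabited : inhabited world;
  int_le : world -> world -> Prop;
  int_le_refl : forall w, int_le w w;
  int_le_trans : forall w v u, int_le w v -> int_le v u -> int_le w u;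
  int_le_antisym : forall w v, int_le w v -> int_le v w -> w = v;
  modal : world -> world -> Prop;
  int_le_modal : forall w v x, int_le w v -> modal v x -> modal w x;
  valuation : world -> nat -> bool;
  valuation_mono : forall w v p, int_le w v -> valuation w p -> valuation v p;
  modal_trans : forall w v u, modal w v -> modal v u -> modal w u;
  modal_cwf : ~ exists path : nat -> world, forall n, modal (path n) (path n.+1);
  modal_int_le : forall w x, modal w x -> int_le w x
}.

Fixpoint forces (M : iSL_box_model) (w : world M) (f : formula) : Prop :=
  match f with
  | Bot => False
  | Atom p => valuation w p
  | And f g => forces w f /\ forces w g
  | Or f g => forces w f \/ forces w g
  | Imp f g => forall v, int_le w v -> forces v f -> forces v g
  | Box f => forall x, modal w x -> forces x f
  end.

Definition forces_ant (M : iSL_box_model) (w : world M)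
    (G : {mset formula}) : Prop :=
  forall f, f \in G -> forces w f.

Definition forces_suc (M : iSL_box_model) (w : world M)
    (D : option formula) : Prop :=
  if D is Some f then forces w f else False.

Definition valid_in (M : iSL_box_model) (G : {mset formula})
    (D : option formula) : Prop :=
  forall w : world M, forces_ant w G -> forces_suc w D.

Definition entails (G : {mset formula}) (D : option formula) : Prop :=
  forall M : iSL_box_model, valid_in M G D.

(* Main.v *)
(* An underivable sequent is refuted by well-founded induction on the pair
   (number of boxed subformulas missing from the antecedent, weight of the
   sequent).  Invertible rules reduce the sequent, unless it contains some
   [Box f] in the antecedent together with [Box f -> g] in the antecedent or
   [Box f] in the succedent; then the premise proving [f] is an instance of the
   identity.  If no invertible rule applies, every remaining premise has a
   refuting model, and these are glued below a new root forcing exactly the atoms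
   of the antecedent: as modal successors for the modal rules, as merely
   intuitionistic successors for the rules of disjunction and of nested
   implication.  Every implication in the antecedent then holds vacuously at the
   new root. *)
Require Import Defs.
From Stdlib Require Import Classical IndefiniteDescription.
From mathcomp Require Import all_boot finmap multiset zify.

Set Implicit Arguments.
Unset Strict Implicit.
Unset Printing Implicit Defensive.

Local Open Scope mset_scope.

(** * Gluing models *)

Section SumRelation.

Variables (I : Type) (T : I -> Type) (R : forall i, T i -> T i -> Prop).

(** The index type has no decidable equality, so points of one component are compared by transport
    along an equality of tags; proof irrelevance later removes the transport. *)
Definition sum_rel (x y : {i & T i}) : Prop :=
  exists e : tag x = tag y, R (eq_rect _ T (tagged x) _ e) (tagged y).

Lemma sum_relE i (u v : T i) :
  sum_rel (existT T i u) (existT T i v) <-> R u v.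
Proof.
split=> [[e]|Ruv]; last by exists erefl.
by rewrite (proof_irrelevance _ e erefl).
Qed.

Lemma sum_rel_inv i (u : T i) y :
  sum_rel (existT T i u) y -> exists2 v, y = existT T i v & R u v.
Proof. by case: y => j v [/= e]; case: j / e v => v /=; exists v. Qed.

End SumRelation.

Lemma forces_mono (M : iSL_box_model) (w v : world M) f :
  int_le w v -> forces w f -> forces v f.
Proof.
elim: f => [|p|f IHf g IHg|f IHf g IHg|f _ g _|f _] //= wv.
- exact: valuation_mono.
- by case=> /(IHf wv) ? /(IHg wv).
- by case=> [/(IHf wv)|/(IHg wv)]; [left|right].
- by move=> H u vu; apply: H; apply: int_le_trans vu.
- by move=> H x vx; apply: H; apply: int_le_modal vx.
Qed.

Lemma forces_ant_add (M : iSL_box_model) (w : world M) f G :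
  forces_ant w (f +` G) <-> forces w f /\ forces_ant w G.
Proof.
split=> [H|[wf wG] g].
  split; first by apply: H; rewrite in_mset1D eqxx.
  by move=> g gG; apply: H; rewrite in_mset1D gG orbT.
by rewrite in_mset1D => /orP[/eqP->|/wG].
Qed.

Section Glue.

(* Below a family of rooted models a new root is added.  It is an intuitionistic
   predecessor of every root, and a modal predecessor of those with [mod i]. *)
Variables (I : Type) (M : I -> iSL_box_model) (root : forall i, world (M i)).
Variables (mod : I -> bool) (V : nat -> bool).
Hypothesis V_root : forall i p, V p -> valuation (root i) p.

Let inner := {i & world (M i)}.
Let outer := option inner.

Let in_le : inner -> inner -> Prop :=
  sum_rel (fun i => @int_le (M i)).
Let in_modal : inner -> inner -> Prop :=
  sum_rel (fun i => @modal (M i)).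

Definition glue_le (x y : outer) : Prop :=
  match x, y with
  | None, None => True
  | None, Some (existT i v) => int_le (root i) v
  | Some _, None => False
  | Some x, Some y => in_le x y
  end.

(** [None] is the new root. As it lies below every old root, [int_le_modal] forces the second
    disjunct. The first takes the whole up-set of a modal root; by monotonicity this changes no
    boxed formula. *)
Definition glue_modal (x y : outer) : Prop :=
  match x, y with
  | None, Some (existT i v) =>
      mod i /\ int_le (root i) v \/ modal (root i) v
  | Some x, Some y => in_modal x y
  | _, None => False
  end.

Definition glue_valuation (x : outer) p : bool :=
  if x is Some (existT i v) then valuation v p else V p.

Let in_le_inv i (u : world (M i)) y :
  in_le (existT _ i u) y -> exists2 v, y = existT _ i v & int_le u v.
Proof. exact: sum_rel_inv. Qed.

Let in_modal_inv i (u : world (M i)) y :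
  in_modal (existT _ i u) y -> exists2 v, y = existT _ i v & modal u v.
Proof. exact: sum_rel_inv. Qed.

Lemma glue_le_refl x : glue_le x x.
Proof. by case: x => // -[i v]; apply/sum_relE/int_le_refl. Qed.

Lemma glue_le_trans x y z : glue_le x y -> glue_le y z -> glue_le x z.
Proof.
case: x y z => [[i u]|] [y|] [z|] //=.
- move=> /in_le_inv[v -> uv] /in_le_inv[t -> vt].
  by apply/sum_relE; apply: int_le_trans vt.
- case: y => j v jv /in_le_inv[t -> vt].
  exact: int_le_trans vt.
Qed.

Lemma glue_le_antisym x y : glue_le x y -> glue_le y x -> x = y.
Proof.
case: x y => [[i u]|] [y|] //= /in_le_inv[v -> uv] /sum_relE vu.
by rewrite (int_le_antisym uv vu).
Qed.

Lemma glue_le_modal x y z : glue_le x y -> glue_modal y z -> glue_modal x z.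
Proof.
case: x y z => [[i u]|] [y|] [z|] //=.
- move=> /in_le_inv[v -> uv] /in_modal_inv[t -> vt].
  by apply/sum_relE; apply: int_le_modal vt.
- case: y => j v jv /in_modal_inv[t -> vt].
  by right; apply: int_le_modal vt.
Qed.

Lemma glue_valuation_mono x y p :
  glue_le x y -> glue_valuation x p -> glue_valuation y p.
Proof.
case: x y => [[i u]|] [y|] //=.
- move=> /in_le_inv[v -> uv]. exact: valuation_mono uv.
- by case: y => j v jv /(V_root j); apply: valuation_mono jv.
Qed.

Lemma glue_modal_le x y : glue_modal x y -> glue_le x y.
Proof.
case: x y => [[i u]|] [y|] //=.
- by move=> /in_modal_inv[v -> uv]; apply/sum_relE/modal_int_le.
- by case: y => j v [[]|/modal_int_le].
Qed.

Lemma glue_modal_trans x y z :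
  glue_modal x y -> glue_modal y z -> glue_modal x z.
Proof. by move=> /glue_modal_le; apply: glue_le_modal. Qed.

(** No point sees the new root, so an infinite path leaves it after at most one step and then stays
    in a single component. *)
Lemma glue_modal_cwf :
  ~ exists path : nat -> outer, forall n, glue_modal (path n) (path n.+1).
Proof.
case=> path pathP.
have [i [u path1]] : exists i u, path 1 = Some (existT _ i u).
  by move: (pathP 0); case: (path 0) (path 1) => [?|] [[i u]|] //; exists i, u.
have in_i n : exists v, path n.+1 = Some (existT _ i v).
  elim: n => [|n [v pathn]]; first by exists u.
  move: (pathP n.+1); rewrite pathn; case: (path n.+2) => //= y.
  by case/in_modal_inv=> t -> _; exists t.
have [f fP] := functional_choice _ in_i.
case: (@modal_cwf (M i)); exists f => n.
by have := pathP n.+1; rewrite !fP => /sum_relE.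
Qed.

Definition glue : iSL_box_model :=
  ISLBoxModel (inhabits None) glue_le_refl glue_le_trans glue_le_antisym
    glue_le_modal glue_valuation_mono glue_modal_trans glue_modal_cwf
    glue_modal_le.

(** Points above or seen from an old point stay in its component: each component is a generated
    submodel. *)
Lemma forces_glue i (u : world (M i)) f :
  @forces glue (Some (existT _ i u)) f <-> forces u f.
Proof.
elim: f u => [|p|f IHf g IHg|f IHf g IHg|f IHf g IHg|f IHf] u //=.
- by rewrite IHf IHg.
- by rewrite IHf IHg.
- split=> [H v uv /IHf vf|H [y|] //= /in_le_inv[v -> uv] /IHf vf].
    by apply/IHg/H => //=; apply/sum_relE.
  by apply/IHg/H.
- split=> [H v uv|H [y|] //= /in_modal_inv[v -> uv]].
    by apply/IHf/H; apply/sum_relE.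
  by apply/IHf/H.
Qed.

Lemma forces_glue_root i f : @forces glue None f -> forces (root i) f.
Proof.
by move=> H; apply/forces_glue; apply: forces_mono H; apply: int_le_refl.
Qed.

(** Apart from the new root itself, every point above it lies above some old root, so only the local
    implication remains to be arranged. *)
Lemma forces_glue_root_imp f g :
  @forces glue None (Imp f g) <->
  (@forces glue None f -> @forces glue None g) /\
  forall i, forces (root i) (Imp f g).
Proof.
split=> [H|[H0 H] [[i v]|] //= iv].
- by split=> [|i]; [apply: (H None)|apply: forces_glue_root H].
- by move=> /forces_glue vf; apply/forces_glue/(H i).
Qed.

Lemma forces_glue_root_box f :
  @forces glue None (Box f) <->
  (forall i, mod i -> forces (root i) f) /\
  forall i, forces (root i) (Box f).
Proof.
split=> [H|[H0 H] [[i v]|] //= [[modi iv]|iv]].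
- split=> [i modi|i v iv]; apply/forces_glue/H => /=; last by right.
  by left; split=> //; apply: int_le_refl.
- by apply/forces_glue; apply: forces_mono iv (H0 i modi).
- by apply/forces_glue/H.
Qed.

End Glue.

Record pointed : Type := Pointed { base : iSL_box_model; point : world base }.

Definition refutes (m : pointed) (G : {mset formula}) D : Prop :=
  forces_ant (point m) G /\ ~ forces_suc (point m) D.

Definition refutable (G : {mset formula}) D : Prop :=
  exists m, refutes m G D.

(** * Identity *)

Definition unbox (f : formula) : option formula :=
  if f is Box g then Some g else None.

Definition unboxed (G : {mset formula}) : {mset formula} :=
  seq_mset (pmap unbox G).

Lemma mem_unboxed G f : (f \in unboxed G) = (Box f \in G).
Proof.
rewrite (perm_mem (perm_eq_seq_mset _)) mem_pmap.
by apply/mapP/idP => [[[] //= g gG [->]]|fG] //; exists (Box f).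
Qed.

(** The split of an antecedent into a part without boxed formulas and a part $\Box\Gamma$, which
    puts any antecedent in the shape required by the modal rules. *)
Lemma mset_boxK (G : {mset formula}) :
  G = seq_mset [seq f <- G | ~~ boxed f] `+` box_mset (unboxed G).
Proof.
have -> : box_mset (unboxed G) = seq_mset [seq f <- G | boxed f].
  apply/eq_seq_msetP; apply: perm_trans (perm_map _ (perm_eq_seq_mset _)) _.
  apply/eq_seq_msetP; congr seq_mset.
  by elim: (enum_mset G) => //= -[] //= f s ->.
apply/msetP=> f; rewrite msetE2 !mset_seqE -count_cat -(count_mem_mset f G).
by apply/permP; rewrite perm_sym perm_catC; apply/permPl/perm_filterC.
Qed.

Lemma mset_boxdotK (G : {mset formula}) :
  seq_mset [seq f <- G | ~~ boxed f] `+` boxdot (unboxed G) =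
  G `+` unboxed G.
Proof. by rewrite {3}[G]mset_boxK msetDAC msetDA. Qed.

Lemma nonboxed_filter (G : {mset formula}) h :
  h \in seq_mset [seq f <- G | ~~ boxed f] -> ~~ boxed h.
Proof. by rewrite (perm_mem (perm_eq_seq_mset _)) mem_filter => /andP[]. Qed.

Lemma G4_R4SL_unboxed G f :
  G4iSL_box' (Box f +` (G `+` unboxed G)) (Some f) ->
  G4iSL_box' G (Some (Box f)).
Proof.
rewrite -mset_boxdotK {3}[G]mset_boxK.
exact: G4_R4SL (@nonboxed_filter G).
Qed.

Lemma G4_ImpSL_unboxed G f g D :
  G4iSL_box' (Box f +` (Imp (Box f) g +` (G `+` unboxed G))) (Some f) ->
  G4iSL_box' (g +` G) D ->
  G4iSL_box' (Imp (Box f) g +` G) D.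
Proof.
rewrite -mset_boxdotK {3 4}[G]mset_boxK.
exact: G4_ImpSL (@nonboxed_filter G).
Qed.

Ltac mset_ac := by apply/msetP=> ?; rewrite ?msetD0 !msetE2; lia.

Lemma G4_cast A B D : G4iSL_box' A D -> A = B -> G4iSL_box' B D.
Proof. by move=> H <-. Qed.

(* The second part is modus ponens on the left; [X] carries formulas that the
   continuation needs, as weakening is not available. *)
Lemma G4_id_mp f :
  (forall G, f \in G -> G4iSL_box' G (Some f)) /\
  (forall g X D, (forall G, G4iSL_box' (g +` (G `+` X)) D) ->
    forall G, G4iSL_box' (Imp f g +` (f +` (G `+` X))) D).
Proof.
elim: f => [|p|a [ida mpa] b [idb mpb]|a [ida mpa] b [idb mpb]
           |a [ida mpa] b [idb mpb]|a [ida mpa]].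
- split=> [G fG|g X D K G].
    by rewrite -(msetB1K fG); apply: G4_LBot.
  by rewrite msetDCA; apply: G4_LBot.
- split=> [G fG|g X D K G].
    by rewrite -(msetB1K fG); apply: G4_At.
  rewrite msetDCA; apply: G4_LAtomImp.
  by apply: G4_cast (K (Atom p +` G)) _; mset_ac.
- split=> [G fG|g X D K G].
    rewrite -(msetB1K fG); apply: G4_LAnd; apply: G4_RAnd.
      by apply: ida; rewrite !in_mset1D eqxx.
    by apply: idb; rewrite !in_mset1D eqxx orbT.
  apply: G4_LAndImp; rewrite msetDCA; apply: G4_LAnd.
  (* [b] joins the carried part, because the second modus ponens, through [mpb], consumes it. *)
  have := mpa (Imp b g) (b +` X) D _ G.
  have -> : Imp a (Imp b g) +` (a +` (G `+` (b +` X))) =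
    a +` (b +` (Imp a (Imp b g) +` (G `+` X))) by mset_ac.
  apply=> H; rewrite (msetDCA H).
  exact: mpb.
- split=> [G fG|g X D K G].
    rewrite -(msetB1K fG); apply: G4_LOr.
      by apply/G4_ROr0/ida; rewrite !in_mset1D eqxx.
    by apply/G4_ROr1/idb; rewrite !in_mset1D eqxx.
  apply: G4_LOrImp.
  rewrite (_ : _ +` _ = Or a b +` (Imp a g +` (Imp b g +` (G `+` X)))); last by mset_ac.
  apply: G4_LOr.
    by apply: G4_cast (mpa g X D K (Imp b g +` G)) _; mset_ac.
  by apply: G4_cast (mpb g X D K (Imp a g +` G)) _; mset_ac.
- split=> [G fG|g X D K G].
    apply: G4_RImp; rewrite -(msetB1K fG).
    have := mpa b mset0 (Some b) _ (G `\ Imp a b).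
    rewrite msetD0 msetDCA; apply=> H.
    by apply: idb; rewrite !in_mset1D eqxx.
  (* The left premise contains both [Imp a b] and [a], hence is again modus ponens for [a], now with
     target [b]. *)
  apply: G4_LImpImp; last by apply: G4_cast (K (Imp a b +` G)) _; mset_ac.
  apply: G4_cast (mpa b mset0 (Some b) _ (Imp b g +` (G `+` X))) _.
    by move=> H; apply: idb; rewrite !in_mset1D eqxx.
  by mset_ac.
- split=> [G fG|g X D K G].
    apply: G4_R4SL_unboxed; apply: ida.
    by rewrite in_mset1D in_msetD mem_unboxed fG !orbT.
  apply: G4_ImpSL_unboxed; last by apply: G4_cast (K (Box a +` G)) _; mset_ac.
  by apply: ida; rewrite 2!in_mset1D in_msetD mem_unboxed mset1D1 !orbT.
Qed.

(** * Saturation *)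

(** A conjunction weighs one more than a disjunction or implication of the same parts, so that
    currying in [G4_LAndImp] lowers the weight. *)
Fixpoint weight (f : formula) : nat :=
  match f with
  | Bot | Atom _ => 1
  | And f g => (weight f + weight g).+2
  | Or f g | Imp f g => (weight f + weight g).+1
  | Box f => (weight f).+1
  end.

(* With base 4, replacing a formula by at most three lighter ones makes a
   sequent smaller. *)
Definition heft (f : formula) : nat := 4 ^ weight f.

Lemma heft_lt f g : weight f < weight g -> heft f * 4 <= heft g.
Proof. by move=> fg; rewrite /heft -expnSr leq_exp2l. Qed.

Lemma heft_gt0 f : 0 < heft f.
Proof. by rewrite /heft expn_gt0. Qed.

Definition ant_heft (G : {mset formula}) : nat := \sum_(f <- G) heft f.

Lemma ant_heft_add f G : ant_heft (f +` G) = heft f + ant_heft G.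
Proof.
rewrite /ant_heft -(big_cons _ _ f (enum_mset G) xpredT heft).
apply: perm_big; rewrite /perm_eq; apply/allP => g _ /=; apply/eqP.
by rewrite !count_mem_mset mset1DE eq_sym.
Qed.

Definition adds (L : seq formula) (G : {mset formula}) : {mset formula} :=
  foldr (fun f A => f +` A) G L.

Lemma ant_heft_adds L G : ant_heft (adds L G) = \sum_(f <- L) heft f + ant_heft G.
Proof.
elim: L => [|f L IH] /=; first by rewrite big_nil.
by rewrite ant_heft_add IH big_cons addnA.
Qed.

Lemma mem_adds L G f : (f \in adds L G) = (f \in L) || (f \in G).
Proof. by elim: L => //= g L IH; rewrite in_mset1D IH inE orbA. Qed.

Definition seq_heft G D : nat := ant_heft G + oapp heft 0 D.

(** The left implication rules create formulas that are not subformulas of the end sequent, but no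
    new boxed subformulas; only the latter are bounded by a fixed list [S]. *)
Fixpoint boxes_in (S : seq formula) (f : formula) : bool :=
  match f with
  | Bot | Atom _ => true
  | And f g | Or f g | Imp f g => boxes_in S f && boxes_in S g
  | Box g => (f \in S) && boxes_in S g
  end.

Lemma boxes_in_sub (S S' : seq formula) f :
  {subset S <= S'} -> boxes_in S f -> boxes_in S' f.
Proof.
move=> SS'; elim: f => //= [f IHf g IHg|f IHf g IHg|f IHf g IHg|f IHf].
- by case/andP => /IHf-> /IHg.
- by case/andP => /IHf-> /IHg.
- by case/andP => /IHf-> /IHg.
- by case/andP => /SS'-> /IHf.
Qed.

Fixpoint boxes (f : formula) : seq formula :=
  match f with
  | Bot | Atom _ => [::]
  | And f g | Or f g | Imp f g => boxes f ++ boxes g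
  | Box g => f :: boxes g
  end.

Lemma boxes_in_boxes f : boxes_in (boxes f) f.
Proof.
have catl s t g : boxes_in s g -> boxes_in (s ++ t) g.
  by apply: boxes_in_sub => h; rewrite mem_cat => ->.
have catr s t g : boxes_in t g -> boxes_in (s ++ t) g.
  by apply: boxes_in_sub => h; rewrite mem_cat orbC => ->.
elim: f => //= [f IHf g IHg|f IHf g IHg|f IHf g IHg|f IHf];
  try by rewrite catl ?catr.
by rewrite mem_head; apply: (catr [:: _]).
Qed.

Definition missing (S : seq formula) (G : {mset formula}) : nat :=
  count (fun f => boxed f && (f \notin G)) S.

Lemma missing_le (S : seq formula) (G G' : {mset formula}) :
  (forall f, boxed f -> f \in G -> f \in G') -> missing S G' <= missing S G.
Proof.
move=> GG'; apply: sub_count => f /andP[bf fG']; rewrite /= bf /=.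
by apply: contra fG'; apply: GG'.
Qed.

(** This pays for the modal rules: they add their diagonal formula to the antecedent, while the
    weight of the sequent may grow. *)
Lemma missing_lt (S : seq formula) (G G' : {mset formula}) f :
  boxed f -> f \in S -> f \notin G -> f \in G' -> {subset G <= G'} ->
  missing S G' < missing S G.
Proof.
move=> bf fS fG fG' GG'.
(* The occurrences of [f] in [S] are split off: all of them count for [G] and none for [G']. *)
have missE A : missing S A = count (fun g => (g != f) && (boxed g && (g \notin A))) S
    + (f \notin A) * count_mem f S.
  rewrite /missing; elim: S {fS} => [|g s] /=; [by rewrite muln0 | move=> ->].
  case: (altP (g =P f)) => [->|] /=; first by rewrite bf; lia.
  by lia.
rewrite !missE fG fG' mul1n addn0 -addn1; apply: leq_add.
  apply: sub_count => g /= /and3P[-> -> gG'].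
  by apply: contra gG'; apply: GG'.
by rewrite -has_count has_pred1.
Qed.

Definition smaller S G' D' G D : Prop :=
  missing S G' < missing S G \/
  missing S G' <= missing S G /\ seq_heft G' D' < seq_heft G D.

Lemma smaller_ind S (P : {mset formula} -> option formula -> Prop) :
  (forall G D, (forall G' D', smaller S G' D' G D -> P G' D') -> P G D) ->
  forall G D, P G D.
Proof.
move=> IH G D.
have [m] := ubnP (missing S G); elim: m G D => // m IHm G D.
have [n] := ubnP (seq_heft G D); elim: n G D => // n IHn G D.
rewrite ltnS => hn hm; apply: IH => G' D' [lt|[le lt]].
  by apply: IHm; apply: leq_trans lt _; rewrite -ltnS.
by apply: IHn; [apply: leq_trans lt _|apply: leq_ltn_trans le _].
Qed.

(* [x.1] tells whether the root of [m] is meant as a modal successor. *)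
Definition obligation (G : {mset formula}) (x : bool * formula) (m : pointed) : Prop :=
  [/\ forces_ant (point m) G,
      x.1 -> forall f, Box f \in G -> forces (point m) f
    & ~ forces (point m) x.2].

Definition met G (k : bool) f : Prop := exists m, obligation G (k, f) m.

(** An implication asks for what makes its own antecedent fail at the new root: a missing atom, or a
    root refuting the nested implication or the body of the box. The shapes sent to [False] are
    removed by an axiom or an invertible rule. *)
Definition saturated_ant (G : {mset formula}) (f : formula) : Prop :=
  match f with
  | Imp (Atom p) _ => Atom p \notin G
  | Imp (Imp f g) _ => met G false (Imp f g)
  | Imp (Box f) _ => met G true f
  | Atom _ | Box _ | Imp Bot _ => True
  | _ => False
  end.

Definition saturated_suc (G : {mset formula}) (D : option formula) : Prop :=
  match D with
  | Some (Atom p) => Atom p \notin G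
  | Some (Or f g) => met G false f /\ met G false g
  | Some (Box f) => met G true f
  | None | Some Bot => True
  | _ => False
  end.

Lemma saturated_refutable G D :
  (forall f, f \in G -> saturated_ant G f) -> saturated_suc G D ->
  refutable G D.
Proof.
move=> satG satD.
pose I := {x : bool * formula | exists m, obligation G x m}.
have [m mP] := functional_choice (fun i : I => obligation G (sval i)) (@svalP _ _).
have mG i : forces_ant (point (m i)) G by have [] := mP i.
have mk (k : bool) f : met G k f ->
    exists2 i : I, k -> (sval i).1 & ~ forces (point (m i)) f.
  move=> kf; exists (exist _ (k, f) kf) => //.
  by have [] := mP (exist _ (k, f) kf).
have V_root i p : Atom p \in G -> valuation (point (m i)) p by exact: mG.
pose N := glue (fun i => (sval i).1) V_root.
have boxN f : met G true f -> ~ @forces N None (Box f).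
  case/mk => i /(_ isT) modi nf /forces_glue_root_box[H _].
  exact/nf/H.
exists (@Pointed N None); split=> /=.
  move=> f fG; have := satG f fG; case: f fG => //= [f g|f] fG; last first.
    move=> _; apply/forces_glue_root_box; split=> i.
      by have [_ H _] := mP i => /H; apply.
    exact: mG.
  move=> satf; apply/forces_glue_root_imp; split=> [Nf|i]; last exact: mG.
  case: f fG satf Nf => //= [p|f h|f] _.
  - by move=> /negP.
  - by case/mk=> i _ nfh /forces_glue_root_imp[_ /(_ i)].
  - by move=> /boxN.
case: D satD => [[|p|f g|f g|f g|f]|] //=; try by move=> // _ [].
- by move=> /negP.
- case=> /mk[i _ nf] /mk[j _ ng] [/(forces_glue_root i)|/(forces_glue_root j)] //.
- by move=> /boxN.
Qed.

(** * Reduction of an underivable, irrefutable sequent to a saturated one *)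

Lemma adds_forces (M : iSL_box_model) (w : world M) L G :
  forces_ant w (adds L G) ->
  foldr (fun f P => forces w f /\ P) (forces_ant w G) L.
Proof.
elim: L => //= f L IH /forces_ant_add[wf wL]; split=> //; exact: IH.
Qed.

Definition seq_boxes_in S (G : {mset formula}) (D : option formula) : Prop :=
  (forall f, f \in G -> boxes_in S f) /\ oapp (boxes_in S) true D.

Section Saturation.

Variables (S : seq formula) (G : {mset formula}) (D : option formula).
Hypothesis SG : seq_boxes_in S G D.
Hypothesis IH : forall G' D', smaller S G' D' G D -> seq_boxes_in S G' D' ->
  ~ refutable G' D' -> G4iSL_box' G' D'.
Hypothesis irrefutable : ~ refutable G D.
Hypothesis underivable : ~ G4iSL_box' G D.

(** A nonboxed principal formula [f] is replaced by the side formulas [L]: the number of missing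
    boxes cannot grow, so a drop in weight suffices. *)
Let premise L D' f : f \in G -> ~~ boxed f -> all (boxes_in S) L ->
  oapp (boxes_in S) true D' ->
  \sum_(g <- L) heft g + oapp heft 0 D' < heft f + oapp heft 0 D ->
  ~ refutable (adds L (G `\ f)) D' ->
  G4iSL_box' (adds L (G `\ f)) D'.
Proof.
move=> fG nbf /allP SL SD' lt; apply: IH.
  right; split; last first.
    by rewrite /seq_heft ant_heft_adds -[in X in _ < X](msetB1K fG) ant_heft_add; lia.
  apply: missing_le => g bg gG; rewrite mem_adds in_msetB1 gG andbT.
  by case: eqP bg => [->|]; rewrite ?orbT // (negPf nbf).
split=> // g; rewrite mem_adds => /orP[/SL //|gG].
by apply: SG.1; move: gG; rewrite in_msetB1 => /andP[].
Qed.

(** Semantic invertibility: when the side formulas force [f], a model refuting the premise refutes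
    the conclusion. *)
Let left_premise L f : f \in G -> ~~ boxed f -> all (boxes_in S) L ->
  \sum_(g <- L) heft g < heft f ->
  (forall M (w : world M), foldr (fun g P => forces w g /\ P) True L -> forces w f) ->
  G4iSL_box' (adds L (G `\ f)) D.
Proof.
move=> fG nbf SL lt sound; apply: premise => //; first exact: SG.2.
  by rewrite ltn_add2r.
case=> m [/adds_forces mL mD]; apply: irrefutable; exists m; split=> //.
rewrite -(msetB1K fG); apply/forces_ant_add; split.
  by apply: sound; elim: L mL {SL lt} => //= g L IHL [? /IHL].
by elim: L mL {SL lt sound} => //= g L IHL [_ /IHL].
Qed.


Ltac lighter f g := have := @heft_lt f g ltac:(rewrite /=; lia).

(** Specifying [G'] by membership alone covers both modal rules. A root refuting the premise forces
    the bodies of all boxes in [G], as a modal successor must. *)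
Let modal_premise G' f : Box f \notin G -> boxes_in S (Box f) ->
  (forall h, h \in G' = [|| h == Box f, h \in G | Box h \in G]) ->
  ~ G4iSL_box' G' (Some f) -> met G true f.
Proof.
move=> fG /= /andP[fS Sf] G'E nG'.
have {nG'} : refutable G' (Some f).
  apply: NNPP => nref; apply: nG'; apply: IH => //.
    left; apply: (missing_lt (f := Box f)) => // [|h hG]; rewrite G'E ?eqxx //.
    by rewrite hG orbT.
  split=> // h; rewrite G'E => /or3P[/eqP->|hG|hG] /=.
  - by rewrite fS.
  - exact: SG.1.
  - by have /andP[] := SG.1 _ hG.
case=> m [mG' nf]; exists m; split=> // [h hG|_ h hG]; apply: mG'.
  by rewrite G'E hG orbT.
by rewrite G'E hG !orbT.
Qed.

Lemma saturation_ant f : f \in G -> saturated_ant G f.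
Proof.
move=> fG; have := SG.1 f fG.
have lp L := left_premise (L := L) fG.
have un : ~ G4iSL_box' (f +` (G `\ f)) D by rewrite msetB1K.
case: f => [|p|a b|a b|a g|a] //= in fG lp un *.
- by case: un; apply: G4_LBot.
- move=> /andP[Sa Sb]; apply: un; apply: G4_LAnd.
  apply: (lp [:: a; b]) => //=; first by rewrite Sa Sb.
    rewrite !big_cons big_nil; lighter a (And a b); lighter b (And a b).
    by have := heft_gt0 (And a b); lia.
  by move=> M w [? []].
- move=> /andP[Sa Sb]; apply: un; apply: G4_LOr.
    apply: (lp [:: a]) => //=; first by rewrite Sa.
      by rewrite big_seq1; lighter a (Or a b); have := heft_gt0 (Or a b); lia.
    by move=> M w [? _]; left.
  apply: (lp [:: b]) => //=; first by rewrite Sb.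
    by rewrite big_seq1; lighter b (Or a b); have := heft_gt0 (Or a b); lia.
  by move=> M w [? _]; right.
case/andP=> Sa Sg.
(* This premise serves [G4_LAtomImp], [G4_LImpImp] and [G4_ImpSL]; it is invertible because [g]
   forces [Imp a g]. *)
have lg : G4iSL_box' (g +` (G `\ Imp a g)) D.
  apply: (lp [:: g]) => //=; first by rewrite Sg.
    by rewrite big_seq1; lighter g (Imp a g); have := heft_gt0 (Imp a g); lia.
  by move=> M w [wg _] v wv _; apply: forces_mono wg.
case: a => [|p|a b|a b|a b|a] //= in fG lp un Sa lg *.
- apply/negP => pG; apply: un.
  have pG' : Atom p \in G `\ Imp (Atom p) g by rewrite in_msetB1 pG.
  rewrite -(msetB1K pG') msetDCA; apply: G4_LAtomImp.
  by rewrite msetDCA (msetB1K pG').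
- move/andP: Sa => [Sa Sb]; apply: un; apply: G4_LAndImp.
  apply: (lp [:: Imp a (Imp b g)]) => //=; first by rewrite Sa Sb Sg.
    rewrite big_seq1; lighter (Imp a (Imp b g)) (Imp (And a b) g).
    by have := heft_gt0 (Imp (And a b) g); lia.
  move=> M w [H _] v wv [va vb].
  by apply: (H v wv va v (int_le_refl v) vb).
- move/andP: Sa => [Sa Sb]; apply: un; apply: G4_LOrImp.
  apply: (lp [:: Imp a g; Imp b g]) => //=; first by rewrite Sa Sb Sg.
    rewrite !big_cons big_nil; lighter (Imp a g) (Imp (Or a b) g).
    lighter (Imp b g) (Imp (Or a b) g).
    by have := heft_gt0 (Imp (Or a b) g); lia.
  by move=> M w [Ha [Hb _]] v wv [/(Ha v wv)|/(Hb v wv)].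
- move/andP: Sa => [Sa Sb].
  (* A model refuting this premise need not refute [D]; it becomes the root that refutes [Imp a b].
     The principal formula holds there thanks to [a] and [Imp b g]. *)
  have [m [mG nb]] : refutable (adds [:: Imp b g; a] (G `\ Imp (Imp a b) g)) (Some b).
    apply: NNPP => /(premise fG isT) H; apply: un; apply: G4_LImpImp lg.
    apply: H => /=; rewrite ?Sa ?Sb ?Sg // !big_cons big_nil.
    lighter (Imp b g) (Imp (Imp a b) g); lighter a (Imp (Imp a b) g).
    lighter b (Imp (Imp a b) g).
    by have := heft_gt0 (Imp (Imp a b) g); lia.
  move: mG => /= /forces_ant_add[mbg /forces_ant_add[ma mG]].
  exists m; split=> //=; last by move=> /(_ _ (int_le_refl _) ma).
  rewrite -(msetB1K fG); apply/forces_ant_add; split=> //= v mv mab.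
  apply: (mbg v mv); apply: mab; first exact: int_le_refl.
  exact: forces_mono ma.
- have [aG|naG] := boolP (Box a \in G `\ Imp (Box a) g).
    case: un; apply: G4_ImpSL_unboxed lg; apply: (G4_id_mp a).1.
    by rewrite !in_mset1D in_msetD mem_unboxed aG !orbT.
  apply: (modal_premise _ _ _ (fun H => un (G4_ImpSL_unboxed H lg))) => //.
    by apply: contra naG => aG; rewrite in_msetB1 aG.
  have GE x : (x \in G) = (x == Imp (Box a) g) || (x \in G `\ Imp (Box a) g).
    by rewrite -in_mset1D msetB1K.
  by move=> h; rewrite !GE !in_mset1D in_msetD mem_unboxed -!orbA.
Qed.

Lemma saturation_suc : saturated_suc G D.
Proof.
(* Shared by conjunction and disjunction, whose right rules leave the antecedent unchanged. *)
have suc_premise f g : D = Some f -> boxes_in S g -> weight g < weight f ->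
    ~ G4iSL_box' G (Some g) -> met G false g.
  move=> Df Sg gf ng.
  have [m [mG mg]] : refutable G (Some g).
    apply: NNPP => nref; apply: ng; apply: IH => //.
      right; split=> //; rewrite /seq_heft Df /=.
      by have := heft_lt gf; have := heft_gt0 f; lia.
    by split=> //; apply: SG.1.
  by exists m.
have : oapp (boxes_in S) true D := SG.2.
case DE: D => [[|p|f g|f g|f g|f]|] //= SD.
- by apply/negP => pG; apply: underivable; rewrite DE; apply: (G4_id_mp _).1.
- have /andP[Sf Sg] := SD.
  apply: underivable; rewrite DE; apply: G4_RAnd; apply: NNPP.
    case/(suc_premise _ f DE Sf); first by rewrite /=; lia.
    move=> m [mG _ nf]; apply: irrefutable; exists m; rewrite DE.
    by split=> // -[/nf].
  case/(suc_premise _ g DE Sg); first by rewrite /=; lia.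
  move=> m [mG _ ng]; apply: irrefutable; exists m; rewrite DE.
  by split=> // -[_ /ng].
- have /andP[Sf Sg] := SD.
  split; apply: (suc_premise _ _ DE) => //=; try lia;
    move=> H; apply: underivable; rewrite DE; [exact: G4_ROr0|exact: G4_ROr1].
- have /andP[Sf Sg] := SD.
  have [m [/forces_ant_add[mf mG] ng]] : refutable (f +` G) (Some g).
    apply: NNPP => nref; apply: underivable; rewrite DE; apply: G4_RImp.
    apply: IH => //.
      right; split.
        by apply: missing_le => h _ hG; rewrite in_mset1D hG orbT.
      rewrite /seq_heft ant_heft_add DE /=.
      by lighter f (Imp f g); lighter g (Imp f g); have := heft_gt0 f; lia.
    by split=> // h; rewrite in_mset1D => /orP[/eqP->|/SG.1].
  apply: irrefutable; exists m; rewrite DE; split=> // H.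
  by apply: ng; apply: H mf; apply: int_le_refl.
- have [fG|nfG] := boolP (Box f \in G).
    by case: underivable; rewrite DE; apply: (G4_id_mp _).1.
  have un : ~ G4iSL_box' (Box f +` (G `+` unboxed G)) (Some f).
    by move/G4_R4SL_unboxed; rewrite -DE.
  apply: modal_premise un => // h.
  by rewrite in_mset1D in_msetD mem_unboxed.
Qed.

End Saturation.

Lemma derivable_or_refutable S G D :
  seq_boxes_in S G D -> ~ refutable G D -> G4iSL_box' G D.
Proof.
move: G D; apply: (@smaller_ind S) => G D IH SG nref; apply: NNPP => un.
apply: (nref); apply: saturated_refutable.
  by move=> f; apply: (saturation_ant SG IH nref un).
exact: (saturation_suc SG IH nref un).
Qed.

Theorem theorem7 (G : {mset formula}) (D : option formula) :
  entails G D -> G4iSL_box' G D.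
Proof.
(* The [oapp] term is the succedent as a list of at most one formula; [S] collects the boxed
   subformulas of the whole sequent. *)
move=> GD; pose S := flatten [seq boxes f | f <- oapp (cons^~ [::]) [::] D ++ G].
have inS f : f \in oapp (cons^~ [::]) [::] D ++ G -> boxes_in S f.
  move=> fGD; apply: boxes_in_sub (boxes_in_boxes f) => g gf.
  by apply/flatten_mapP; exists f.
apply: (@derivable_or_refutable S).
  split=> [f fG|]; first by apply: inS; rewrite mem_cat fG orbT.
  by case DE: D => [f|] //=; apply: inS; rewrite DE mem_head.
by case=> m [mG mD]; apply/mD/GD.
Qed.
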